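(* Let $\mathbb{F}$ and $\mathbb{K}$ be fields of characteristics different from $2$, and let $n\ge 2$ and $k\ge 1$. If $\operatorname{char}(\mathbb{F})\ne\operatorname{char}(\mathbb{K})$, then every Jordan multiplicative map $M_n(\mathbb{F})^+\to M_k(\mathbb{K})^+$ is constant with idempotent value.
   Context: For a field $\mathbb{L}$ of characteristic different from $2$, $M_m(\mathbb{L})^+$ denotes the set of $m\times m$ matrices over $\mathbb{L}$ with the product $X\circ Y:=\frac12(XY+YX)$. A map $\phi:M_n(\mathbb{F})^+\to M_k(\mathbb{K})^+$ is Jordan multiplicative if $\phi(X\circ Y)=\phi(X)\circ\phi(Y)$ for all $X,Y$ (no additivity is assumed). *)

(* Defs.v *)
From mathcomp Require Import all_boot all_order all_algebra.

Set Implicit Arguments.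
Unset Strict Implicit.
Unset Printing Implicit Defensive.

Import GRing.Theory.
Local Open Scope ring_scope.

Definition jordan_mul (L : fieldType) (m : nat) (X Y : 'M[L]_m) : 'M[L]_m :=
  2%:R^-1 *: (X *m Y + Y *m X).

Definition jordan_multiplicative (F K : fieldType) (n k : nat)
    (phi : 'M[F]_n -> 'M[K]_k) : Prop :=
  forall X Y : 'M[F]_n,
    phi (jordan_mul X Y) = jordan_mul (phi X) (phi Y).

(* [[pchar L]] is the set of primes that vanish in [L]: it is [{p}] in
   characteristic [p > 0] and empty in characteristic [0], so two fields have
   the same characteristic iff these sets have the same elements. *)
Definition same_char (F K : fieldType) : Prop := [pchar F] =i [pchar K].

(* Main.v *)
Require Import Defs.
From mathcomp Require Import all_boot all_order all_algebra.
From mathcomp Require Import ring.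

Set Implicit Arguments.
Unset Strict Implicit.
Unset Printing Implicit Defensive.

Import GRing.Theory.
Local Open Scope ring_scope.

(** Subtracting the idempotent [phi 0] reduces to the case [phi 0 = 0]. Put
    [psi a = phi (E_ii + a E_ij)]. Since
    [(E_ii + a E_ij) o (E_ii + b E_ij) = E_ii + (a + b)/2 E_ij] and
    [(E_ii + a E_ij) o (E_ii - E_jj) = E_ii], a Peirce computation relative to
    the idempotent [phi E_ii] shows that [psi] preserves midpoints, so that
    [psi a - psi 0] is additive in [a]. If the characteristics differ, this
    forces [psi 1 = psi 0]; multiplying by [E_jj] gives [phi (E_ij / 2) = 0],
    hence [phi E_ii = 0], and from there [phi 1 = 0] and [phi = 0]. *)

(** * The Jordan product and Peirce components relative to an idempotent *)

Section JordanProduct.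
Variables (L : fieldType) (m : nat).
Hypothesis charL : 2%N \notin [pchar L].
Implicit Types X Y e p q T : 'M[L]_m.

Lemma two_neq0 : 2%:R != 0 :> L.
Proof. by move: charL; rewrite inE. Qed.

Lemma jordan_mul_eq X Y Z :
  jordan_mul X Y = Z <-> X *m Y + Y *m X = Z + Z.
Proof.
rewrite /jordan_mul -mulr2n -scaler_nat; split=> [<-|->].
  by rewrite scalerA divff ?scale1r ?two_neq0.
by rewrite scalerA mulVf ?scale1r ?two_neq0.
Qed.

Lemma mx_double_inj X Y : X + X = Y + Y -> X = Y.
Proof.
rewrite -!mulr2n -!scaler_nat => /(congr1 (fun Z => 2%:R^-1 *: Z)).
by rewrite !scalerA mulVf ?scale1r ?two_neq0.
Qed.

Lemma jordan_mulC X Y : jordan_mul X Y = jordan_mul Y X.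
Proof. by rewrite /jordan_mul addrC. Qed.

Lemma jordan_mulBl X Y Z :
  jordan_mul (X - Y) Z = jordan_mul X Z - jordan_mul Y Z.
Proof. by rewrite /jordan_mul mulmxBl mulmxBr -scalerBr opprD addrACA. Qed.

Lemma jordan_mul0l X : jordan_mul 0 X = 0.
Proof. by rewrite /jordan_mul mul0mx mulmx0 addr0 scaler0. Qed.

Lemma jordan_mulxx X : jordan_mul X X = X *m X.
Proof. exact/jordan_mul_eq. Qed.

Lemma jordan_mul1l X : jordan_mul 1%:M X = X.
Proof. by apply/jordan_mul_eq; rewrite mul1mx mulmx1. Qed.

(** Multiplying [T e + e T = 2 e] by [e] on either side gives [e T e + e T = 2 e = T e + e T e], so
    [T] and [e] commute. *)
Lemma jordan_mul_fix_idem e T : e *m e = e -> jordan_mul T e = e ->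
  e *m T = e /\ T *m e = e.
Proof.
move=> ee /jordan_mul_eq TeeT.
have eqT : e *m T = T *m e.
  have := congr1 (mulmx e) TeeT; have := congr1 (mulmx^~ e) TeeT.
  rewrite /= !mulmxDl !mulmxDr !mulmxA ee -!mulmxA ee => <-.
  by rewrite addrC => /addIr.
by split; apply: mx_double_inj; rewrite -TeeT eqT.
Qed.

(* The hypothesis on [q] kills the corner of [p] opposite to [e]. *)
Lemma peirce_half e p q T :
    e *m e = e -> jordan_mul T e = e -> jordan_mul p T = e ->
    jordan_mul q e = p ->
  e *m p *m e = e /\ p = e *m p + p *m e - e.
Proof.
move=> ee /(jordan_mul_fix_idem ee) [eT Te] /jordan_mul_eq pT /jordan_mul_eq qp.
(* Compressing [p T + T p = 2 e] by [e] on both sides leaves [2 e p e = 2 e], as [e T = T e = e]. *)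
have epe : e *m p *m e = e.
  apply: mx_double_inj.
  move/(congr1 (fun Z => e *m Z *m e)): pT.
  by rewrite !mulmxDr !mulmxDl -!mulmxA Te !mulmxA eT ee -!mulmxA ee.
split=> //; apply: mx_double_inj.
have eqe : e *m q *m e = e.
  apply: mx_double_inj; have := congr1 (fun Z => e *m Z *m e) qp.
  by rewrite /= !mulmxDr !mulmxDl epe !mulmxA ee -!mulmxA ee.
rewrite addrACA -opprD (addrACA (e *m p)) -mulmxDr -mulmxDl -qp.
rewrite mulmxDr mulmxDl !mulmxA ee -(mulmxA q) ee eqe.
by apply/matrixP=> x y; rewrite !mxE; ring.
Qed.

Lemma peirce_mull e p q : e *m p *m e = e -> q = e *m q + q *m e - e ->
  e *m p *m q = e *m q + e *m p *m q *m e - e.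
Proof.
move=> epe Dq; rewrite {1}Dq mulmxBr mulmxDr epe.
by rewrite (mulmxA _ e) epe (mulmxA _ q).
Qed.

Lemma peirce_mulr e p q : e *m q *m e = e -> p = e *m p + p *m e - e ->
  p *m q *m e = e *m p *m q *m e + p *m e - e.
Proof.
move=> eqe Dp; rewrite {1}Dp !mulmxBl !mulmxDl eqe.
by rewrite -(mulmxA p) -(mulmxA p) eqe.
Qed.

(** Products of [p] and [q] enter [e r] and [r e] only through the corner [e p q e + e q p e], which
    equals [2 e] by compressing the product relation. What remains is linear in [p] and [q]. *)
Lemma peirce_midpoint e p q r :
    jordan_mul p q = r ->
    e *m p *m e = e -> p = e *m p + p *m e - e ->
    e *m q *m e = e -> q = e *m q + q *m e - e ->
    e *m r *m e = e -> r = e *m r + r *m e - e ->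
  r + r = p + q.
Proof.
move=> /jordan_mul_eq pq epe Dp eqe Dq ere Dr.
have corner : e *m p *m q *m e + e *m q *m p *m e = e + e.
  have := congr1 (fun Z => e *m Z *m e) pq.
  by rewrite /= !mulmxDr !mulmxDl ere !mulmxA.
have half_l : e *m r + e *m r = e *m p + e *m q.
  rewrite -mulmxDr -pq mulmxDr !mulmxA (peirce_mull epe Dq) (peirce_mull eqe Dp).
  by rewrite addrACA -opprD addrACA corner addrK addrC.
have half_r : r *m e + r *m e = p *m e + q *m e.
  rewrite -mulmxDl -pq mulmxDl (peirce_mulr eqe Dp) (peirce_mulr epe Dq).
  by rewrite addrACA -opprD addrACA corner addrC addKr.
rewrite Dr addrACA (addrACA (e *m r)) half_l half_r (addrACA (e *m p)).
by rewrite [LHS]addrACA -Dp -Dq.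
Qed.

End JordanProduct.

(** * Jordan identities between matrix units and coordinate projections *)

Section MatrixUnits.
Variables (F : fieldType) (n : nat).
Hypothesis charF : 2%N \notin [pchar F].
Implicit Types (i j : 'I_n) (a b : F).


Definition shear i j a : 'M[F]_n := delta_mx i i + a *: delta_mx i j.

Lemma shear0 i j : shear i j 0 = delta_mx i i.
Proof. by rewrite /shear scale0r addr0. Qed.

Local Ltac delta_compute ij :=
  (* [h2] is kept in context for the nonzero side conditions of [field]. *)
  have h2 := two_neq0 charF; apply/(jordan_mul_eq charF);
  rewrite ?(mulmxDl, mulmxDr, mulmxN, mulNmx, =^~ scalemxAl, =^~ scalemxAr);
  rewrite !mul_delta_mx_cond ?eqxx ?(negPf ij) 1?[_ == _ :> 'I_n]eq_sym;
  rewrite ?(negPf ij) ?eqxx ?mulr0n ?mulr1n;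
  apply/matrixP=> x y; rewrite !mxE; try (by field).

Lemma shear_mid i j a b : i != j ->
  jordan_mul (shear i j a) (shear i j b) = shear i j (2%:R^-1 * (a + b)).
Proof. by move=> ij; rewrite /shear; delta_compute ij. Qed.

Lemma shear_reflect i j a : i != j ->
  jordan_mul (shear i j a) (delta_mx i i - delta_mx j j) = delta_mx i i.
Proof. by move=> ij; rewrite /shear; delta_compute ij. Qed.

Lemma reflect_delta i j : i != j ->
  jordan_mul (delta_mx i i - delta_mx j j) (delta_mx i i)
    = delta_mx i i :> 'M[F]_n.
Proof. by move=> ij; delta_compute ij. Qed.

Lemma shear_delta i j a : i != j ->
  jordan_mul (shear i j a) (delta_mx j j) = (2%:R^-1 * a) *: delta_mx i j.
Proof. by move=> ij; rewrite /shear; delta_compute ij. Qed.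

(** The first factor is the one [shear_delta] yields at [a = 1]; the 4 cancels its half and the half
    in the Jordan product. *)
Lemma delta_sym i j : i != j ->
  jordan_mul (2%:R^-1 *: delta_mx i j) (4%:R *: delta_mx j i)
    = delta_mx i i + delta_mx j j :> 'M[F]_n.
Proof. by move=> ij; delta_compute ij. Qed.

Lemma delta_add_delta i j : i != j ->
  jordan_mul (delta_mx i i + delta_mx j j) (delta_mx i i)
    = delta_mx i i :> 'M[F]_n.
Proof. by move=> ij; delta_compute ij. Qed.

Definition coord_proj (s : seq 'I_n) : 'M[F]_n := \sum_(l <- s) delta_mx l l.

Lemma coord_proj_mull s i j : i \notin s -> coord_proj s *m delta_mx i j = 0.
Proof.
move=> si; rewrite mulmx_suml big_seq big1 // => l sl.
by rewrite mul_delta_mx_0 //; apply: contraNneq si => <-.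
Qed.

Lemma coord_proj_mulr s i j : j \notin s -> delta_mx i j *m coord_proj s = 0.
Proof.
move=> sj; rewrite mulmx_sumr big_seq big1 // => l sl.
by rewrite mul_delta_mx_0 //; apply: contraNneq sj => ->.
Qed.

Lemma coord_proj_idem s : uniq s -> coord_proj s *m coord_proj s = coord_proj s.
Proof.
elim: s => [|i s IHs] /=; first by rewrite /coord_proj big_nil mul0mx.
case/andP=> si /IHs; rewrite /coord_proj big_cons -/(coord_proj s) => IH.
rewrite mulmxDl !mulmxDr coord_proj_mull // coord_proj_mulr // IH.
by rewrite mul_delta_mx addr0 add0r.
Qed.

(** The swap part has one index inside and one outside [i :: s], so the projection halves it; the
    factor 2 compensates. *)
Lemma coord_proj_compress i t s : uniq [:: t, i & s] ->
  jordan_mul (coord_proj (i :: s))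
      (coord_proj s + 2%:R *: (delta_mx i t + delta_mx t i))
    = coord_proj s + (delta_mx i t + delta_mx t i).
Proof.
rewrite /= inE negb_or -andbA => /and4P[ti ts si Us]; have it := ti.
rewrite eq_sym in it; apply/(jordan_mul_eq charF).
rewrite /coord_proj big_cons -/(coord_proj s).
rewrite ?(mulmxDl, mulmxDr, =^~ scalemxAl, =^~ scalemxAr) coord_proj_idem //.
rewrite !coord_proj_mull // !coord_proj_mulr // !mul_delta_mx_cond.
rewrite !eqxx (negPf ti) (negPf it) !mulr0n !mulr1n.
by apply/matrixP=> x y; rewrite !mxE; ring.
Qed.

(** The swap of [i] and [t] squares to the projection on these two coordinates and is orthogonal to
    [coord_proj s]. *)
Lemma coord_proj_swap_sq i t s : uniq [:: t, i & s] ->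
  let A := coord_proj s + (delta_mx i t + delta_mx t i) in
  jordan_mul A A = coord_proj [:: t, i & s].
Proof.
rewrite /= inE negb_or -andbA => /and4P[ti ts si Us]; have it := ti.
rewrite eq_sym in it; rewrite (jordan_mulxx charF).
rewrite /coord_proj !big_cons -/(coord_proj s).
rewrite ?(mulmxDl, mulmxDr) coord_proj_idem //.
rewrite !coord_proj_mull // !coord_proj_mulr // !mul_delta_mx_cond.
rewrite !eqxx (negPf ti) (negPf it) !mulr0n !mulr1n.
by apply/matrixP=> x y; rewrite !mxE; ring.
Qed.

Lemma coord_projT : coord_proj (enum 'I_n) = 1%:M.
Proof. by rewrite /coord_proj big_enum mx1_sum_delta. Qed.

End MatrixUnits.

(** * Jordan multiplicative maps that send 0 to 0 *)

Section ZeroPreserving.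
Variables (F K : fieldType) (n k : nat).
Hypotheses (charF : 2%N \notin [pchar F]) (charK : 2%N \notin [pchar K]).
Variable phi : 'M[F]_n -> 'M[K]_k.
Hypotheses (phiJ : jordan_multiplicative phi) (phi0 : phi 0 = 0).

(** Adding a coordinate [t] gives the Jordan square of a Jordan multiple of the smaller projection,
    so vanishing propagates. *)
Lemma coord_proj_vanish i s : uniq (i :: s) -> phi (delta_mx i i) = 0 ->
  phi (coord_proj F (i :: s)) = 0.
Proof.
elim: s i => [|t s IHs] i Us phi_i; first by rewrite /coord_proj big_seq1.
have Uis : uniq (i :: s).
  by move: Us; rewrite /= inE negb_or => /and3P[/andP[_ ->] _ ->].
have perm_it : perm_eq [:: i, t & s] [:: t, i & s].
  by rewrite -[[:: i, t & s]]/([:: i; t] ++ s) -[[:: t, i & s]]/([:: t; i] ++ s)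
     perm_cat2r (perm_catC [:: i] [:: t]).
have Uti : uniq [:: t, i & s] by rewrite -(perm_uniq perm_it).
rewrite /coord_proj (perm_big _ perm_it) -/(coord_proj F _).
rewrite -(coord_proj_swap_sq charF Uti) phiJ -(coord_proj_compress charF Uti).
by rewrite phiJ (IHs _ Uis phi_i) !jordan_mul0l.
Qed.

Lemma delta_vanish i : phi (delta_mx i i) = 0 -> forall X, phi X = 0.
Proof.
move=> phi_i X; rewrite -[X](jordan_mul1l charF) phiJ -(coord_projT F n).
have perm_i := perm_to_rem (mem_enum 'I_n i).
rewrite /coord_proj (perm_big _ perm_i) -/(coord_proj F _).
by rewrite coord_proj_vanish ?jordan_mul0l // -(perm_uniq perm_i) enum_uniq.
Qed.

Section TwoIndices.
Variables (i j : 'I_n).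
Hypothesis ij : i != j.

Let psi a := phi (shear i j a).

Lemma shear_image_add a b : psi (a + b) + psi 0 = psi a + psi b.
Proof.
pose e := phi (delta_mx i i); pose T := phi (delta_mx i i - delta_mx j j).
have ee : e *m e = e.
  by rewrite -(jordan_mulxx charK) -phiJ (jordan_mulxx charF) mul_delta_mx.
have Te : jordan_mul T e = e by rewrite -phiJ reflect_delta.
have peirce c : e *m psi c *m e = e /\ psi c = e *m psi c + psi c *m e - e.
  (* The shear at [c] is the midpoint of those at [2 c] and 0, the latter being the idempotent
     [delta_mx i i]. *)
  apply: (peirce_half charK (T := T) (q := psi (2%:R * c))) => //.
    by rewrite -phiJ shear_reflect.
  rewrite /e /psi -(shear0 F i j) -phiJ shear_mid //.
  by rewrite addr0 (mulKf (two_neq0 charF)).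
have mid c d : psi (2%:R^-1 * (c + d)) + psi (2%:R^-1 * (c + d)) = psi c + psi d.
  have [[? ?] [? ?]] := (peirce c, peirce d).
  have [? ?] := peirce (2%:R^-1 * (c + d)).
  apply: (peirce_midpoint charK (e := e)) => //.
  by rewrite -phiJ shear_mid.
(* The pairs [(a + b, 0)] and [(a, b)] have the same midpoint. *)
by rewrite -[RHS]mid -[LHS]mid addr0.
Qed.

Lemma shear_image_nat a m :
  psi (m%:R * a) - psi 0 = m%:R *: (psi a - psi 0).
Proof.
elim: m => [|m IHm]; first by rewrite mul0r subrr scale0r.
rewrite -natr1 mulrDl mul1r -[in RHS]natr1 scalerDl scale1r -IHm.
by rewrite -[psi (_ + a)](addrK (psi 0)) shear_image_add -addrA [LHS]addrACA.
Qed.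

Lemma shear_image_const : psi 1 = psi 0 -> forall X, phi X = 0.
Proof.
move=> psi10; apply: (@delta_vanish i).
(* This exhibits [delta_mx i i] as an iterated Jordan multiple of half of [delta_mx i j]. *)
rewrite -(delta_add_delta charF ij) phiJ -(delta_sym charF ij) phiJ.
rewrite -[2%:R^-1]mulr1 -shear_delta // phiJ -/(psi 1) psi10 -phiJ.
by rewrite shear_delta // mulr0 scale0r phi0 !jordan_mul0l.
Qed.

Lemma same_char_of_neq0 X : phi X != 0 -> same_char F K.
Proof.
move=> phiX p; rewrite !inE; congr (_ && _).
have psi1 : psi 1 - psi 0 != 0.
  by rewrite subr_eq0; apply: contra_neqN phiX => /eqP/shear_image_const ->.
apply/idP/idP => p0.
  have := shear_image_nat 1 p; rewrite (eqP p0) mul0r subrr => /esym/eqP.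
  by rewrite scaler_eq0 (negPf psi1) orbF.
(* If [p] is invertible in [F] but zero in [K], additivity at [1 / p] forces [psi 1 = psi 0]. *)
apply: contraNT psi1 => pF; have := shear_image_nat p%:R^-1 p.
by rewrite divff // (eqP p0) scale0r => ->.
Qed.

End TwoIndices.
End ZeroPreserving.

Theorem corollary4p2 (F K : fieldType) (n k : nat)
    (charF : 2%N \notin [pchar F]) (charK : 2%N \notin [pchar K])
    (n_ge2 : (2 <= n)%N) (k_ge1 : (1 <= k)%N)
    (charFK : ~ same_char F K)
    (phi : 'M[F]_n -> 'M[K]_k) (phiJ : jordan_multiplicative phi) :
  exists P : 'M[K]_k, P *m P = P /\ forall X : 'M[F]_n, phi X = P.
Proof.
(* Since [phi 0] absorbs every value of [phi], the cross terms collapse and subtracting it preserves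
   multiplicativity. *)
have JP X : jordan_mul (phi 0) (phi X) = phi 0 by rewrite -phiJ jordan_mul0l.
pose phi' X := phi X - phi 0.
have phi'J : jordan_multiplicative phi'.
  move=> X Y; rewrite /phi' phiJ !jordan_mulBl !(jordan_mulC _ (_ - _)).
  by rewrite !jordan_mulBl JP !(jordan_mulC _ (phi 0)) !JP subrr subr0 jordan_mulC.
have phi'0 : phi' 0 = 0 by rewrite /phi' subrr.
exists (phi 0); split; first by rewrite -(jordan_mulxx charK) JP.
move=> X; apply/eqP; rewrite -subr_eq0; apply/negPn/negP => phi'X.
pose i := Ordinal (ltnW n_ge2); pose j := Ordinal n_ge2.
exact/charFK/(same_char_of_neq0 charF charK phi'J phi'0 (isT : i != j) phi'X).
Qed.
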